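(* Let $\mathbb{F}$ be a field of characteristic not two, $\eta\in\mathbb{F}\setminus\{1,\frac12\}$, and let $A$ be a primitive $\mathcal{PC}(\eta)$-axial algebra over $\mathbb{F}$. Then $A$ is the linear span of its set of primitive axes. In particular, there exists a basis of $A$ consisting of primitive axes.
   Context: Algebras are not assumed associative or unital. For a commutative $\mathbb{F}$-algebra $A$, $a\in A$ and $\lambda\in\mathbb{F}$, put $A_\lambda(a)=\{u\in A\mid au=\lambda u\}$. A ($\mathcal{PC}(\eta)$-)axis in $A$ is an idempotent $a\in A$ such that $A=A_1(a)\oplus A_\eta(a)\oplus A_{1/2}(a)$ and the fusion law $\mathcal{PC}(\eta)$ holds: $A_1(a)A_1(a)\subseteq A_1(a)$, $A_1(a)A_\eta(a)\subseteq A_\eta(a)$, $A_1(a)A_{1/2}(a)\subseteq A_{1/2}(a)$, $A_\eta(a)A_\eta(a)\subseteq A_1(a)$, $A_\eta(a)A_{1/2}(a)\subseteq A_{1/2}(a)$, $A_{1/2}(a)A_{1/2}(a)\subseteq A_1(a)\oplus A_\eta(a)$. An axis $a$ is primitive if $A_1(a)=\langle a\rangle$ is $1$-dimensional. A $\mathcal{PC}(\eta)$-axial algebra is a commutative $\mathbb{F}$-algebra generated by a set of axes; it is primitive if it is generated by a set of primitive axes. *)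

(* Defs.v *)
From mathcomp Require Import all_boot all_order all_algebra.
From mathcomp Require Import boolp classical_sets.
Set Implicit Arguments.
Unset Strict Implicit.
Unset Printing Implicit Defensive.
Import GRing.Theory.
Local Open Scope classical_set_scope.
Local Open Scope ring_scope.

(* A possibly infinite-dimensional, non-associative, non-unital F-algebra is a
   left F-module A together with a bilinear product mul. *)

Section LinearNotions.
Variables (F : fieldType) (V : lmodType F).
Implicit Types (X U W Z : set V).

Definition linear_span X : set V :=
  [set v | exists (s : seq V) (c : V -> F),
     (forall x, x \in s -> X x) /\ v = \sum_(x <- s) c x *: x].

Definition linearly_independent X : Prop :=
  forall (s : seq V) (c : V -> F), uniq s -> (forall x, x \in s -> X x) ->
    \sum_(x <- s) c x *: x = 0 -> forall x, x \in s -> c x = 0.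

Definition is_basis X : Prop :=
  linearly_independent X /\ linear_span X = [set: V].

Definition sum_set U W : set V := [set u + w | u in U & w in W].

Definition is_direct_sum3 U W Z : Prop :=
  forall v : V, exists! t : V * V * V,
    [/\ U t.1.1, W t.1.2, Z t.2 & v = t.1.1 + t.1.2 + t.2].

End LinearNotions.

Section AxialAlgebra.
Variables (F : fieldType) (A : lmodType F) (mul : {bilinear A -> A -> A}).
Implicit Types (a : A) (lambda eta : F) (X S U W : set A).

Definition subalgebra S : Prop :=
  [/\ S 0,
      forall (k : F) (u v : A), S u -> S v -> S (k *: u + v)
    & forall u v : A, S u -> S v -> S (mul u v)].

Definition generates X : Prop := smallest subalgebra X = [set: A].

Definition eigspace a lambda : set A := [set u | mul a u = lambda *: u].

(* Only the set of products, not its span: each right-hand side of the fusion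
   law is a subspace, so the inclusions mean the same thing. *)
Definition mul_set U W : set A := [set mul u w | u in U & w in W].

Record PC_fusion eta a : Prop := PCFusion {
  fusion_1_1 :
    mul_set (eigspace a 1) (eigspace a 1) `<=` eigspace a 1;
  fusion_1_eta :
    mul_set (eigspace a 1) (eigspace a eta) `<=` eigspace a eta;
  fusion_1_half :
    mul_set (eigspace a 1) (eigspace a 2^-1) `<=` eigspace a 2^-1;
  fusion_eta_eta :
    mul_set (eigspace a eta) (eigspace a eta) `<=` eigspace a 1;
  fusion_eta_half :
    mul_set (eigspace a eta) (eigspace a 2^-1) `<=` eigspace a 2^-1;
  fusion_half_half :
    mul_set (eigspace a 2^-1) (eigspace a 2^-1)
      `<=` sum_set (eigspace a 1) (eigspace a eta)
}.

Definition PC_axis eta a : Prop :=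
  [/\ mul a a = a,
      is_direct_sum3 (eigspace a 1) (eigspace a eta) (eigspace a 2^-1)
    & PC_fusion eta a].

Definition primitive_PC_axis eta a : Prop :=
  [/\ PC_axis eta a, a != 0 & eigspace a 1 = [set k *: a | k in [set: F]]].

Definition primitive_PC_axial_algebra eta : Prop :=
  commutative mul /\
  exists X, X `<=` [set a | primitive_PC_axis eta a] /\ generates X.

End AxialAlgebra.

(* Main.v *)
(* If a is a PC(eta)-axis, the fusion law makes A = (A_1 + A_eta) + A_{1/2} a
   Z/2-grading, so the map tau that negates A_{1/2}(a) is an involutive
   automorphism of A and sends primitive axes to primitive axes. If moreover a
   is primitive and b = k a + y + z is the decomposition of b, then y and z are
   linear combinations of a, b and tau b, hence so is ab = k a + eta y + z / 2.
   The span of the primitive axes is therefore closed under multiplication, and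
   being a subalgebra that contains the generators it is all of A. *)
Require Import Defs.
From HB Require Import structures.
From mathcomp Require Import all_boot all_order all_algebra.
From mathcomp Require Import boolp classical_sets.
Import GRing.Theory.
Local Open Scope classical_set_scope.
Local Open Scope ring_scope.

(** * Finite linear combinations and spans *)

Section LinearSpan.
Set Implicit Arguments.
Unset Strict Implicit.
Variables (F : fieldType) (V : lmodType F).
Implicit Types (X B : set V) (s t : seq V).

(* [linear_span] allows repeated vectors; over a duplicate-free list the
   coefficients of a repeated vector are added up. *)
Lemma sum_scale_uniq s t (c : V -> F) : uniq t -> {subset s <= t} ->
  \sum_(x <- s) c x *: x = \sum_(y <- t) (\sum_(x <- s | x == y) c x) *: y.
Proof.
move=> t_uniq s_t.
have -> : \sum_(y <- t) (\sum_(x <- s | x == y) c x) *: y =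
    \sum_(y <- t) \sum_(x <- s | x == y) c x *: x.
  by apply: eq_bigr => y _; rewrite scaler_suml; apply: eq_bigr => x /eqP->.
(* After the exchange, each [x] of [s] meets exactly one [y] of the duplicate-free list [t], namely
   [x] itself. *)
rewrite (exchange_big_dep predT) //= big_seq [RHS]big_seq.
apply: eq_bigr => x /s_t x_t; rewrite big_mkcond (bigD1_seq x) //= eqxx.
by rewrite big1 ?addr0 // => y; rewrite eq_sym => /negPf->.
Qed.

Lemma linear_span_linear X (k : F) (u v : V) :
  linear_span X u -> linear_span X v -> linear_span X (k *: u + v).
Proof.
move=> [s [c [sX ->]]] [t [d [tX ->]]].
(* [c] and [d] may disagree on a vector common to [s] and [t], so both sums are moved to one
   duplicate-free list, where coefficients can be added. *)
pose r := undup (s ++ t).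
exists r, (fun y => k * (\sum_(x <- s | x == y) c x) +
                    \sum_(x <- t | x == y) d x).
split=> [x|]; first by rewrite mem_undup mem_cat => /orP[/sX|/tX].
have s_r : {subset s <= r} by move=> x; rewrite mem_undup mem_cat => ->.
have t_r : {subset t <= r} by move=> x; rewrite mem_undup mem_cat orbC => ->.
rewrite (sum_scale_uniq c (undup_uniq _) s_r).
rewrite (sum_scale_uniq d (undup_uniq _) t_r).
rewrite scaler_sumr -big_split /=; apply: eq_bigr => y _.
by rewrite scalerA scalerDl.
Qed.

Lemma linear_span0 X : linear_span X 0.
Proof. by exists [::], (fun=> 0); rewrite big_nil. Qed.

Lemma linear_spanZ X (k : F) (u : V) : linear_span X u -> linear_span X (k *: u).
Proof.
move=> Xu; rewrite -[k *: u]addr0.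
exact: linear_span_linear Xu (linear_span0 X).
Qed.

Lemma linear_spanD X (u v : V) :
  linear_span X u -> linear_span X v -> linear_span X (u + v).
Proof. by move=> Xu; rewrite -[u]scale1r; apply: linear_span_linear. Qed.

Lemma linear_spanB X (u v : V) :
  linear_span X u -> linear_span X v -> linear_span X (u - v).
Proof.
by move=> Xu Xv; rewrite addrC -scaleN1r; apply: linear_span_linear.
Qed.

Lemma linear_span_sum X s (f : V -> V) :
  (forall x, x \in s -> linear_span X (f x)) ->
  linear_span X (\sum_(x <- s) f x).
Proof.
elim: s => [|x s IHs] Xf; first by rewrite big_nil; exact: linear_span0.
rewrite big_cons; apply: linear_spanD; first by apply: Xf; rewrite mem_head.
by apply: IHs => y ys; apply: Xf; rewrite inE ys orbT.
Qed.

Lemma sub_linear_span X : X `<=` linear_span X.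
Proof.
move=> x Xx; exists [:: x], (fun=> 1).
by rewrite big_seq1 scale1r; split=> // y; rewrite inE => /eqP->.
Qed.

Lemma linear_span_sub X B : X `<=` linear_span B ->
  linear_span X `<=` linear_span B.
Proof.
move=> XB _ [s [c [sX ->]]]; apply: linear_span_sum => x /sX/XB.
exact: linear_spanZ.
Qed.

(** * Linear independence and existence of bases *)

(** A nonzero coefficient of [x] would let the relation be solved for [x], placing it in the span of
    [B]. Once that coefficient vanishes, only a relation inside [B] is left. *)
Lemma linearly_independent_setU1 B (x : V) :
  linearly_independent B -> ~ linear_span B x ->
  linearly_independent (B `|` [set x]).
Proof.
move=> indB xNB s c s_uniq sBx sum0.
have sB y : y \in s -> y != x -> B y.
  by move=> /sBx[//|->]; rewrite eqxx.
have [xs|xNs] := boolP (x \in s); last first.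
  by apply: indB => // y ys; apply: sB => //; apply: contraNneq xNs => <-.
move: sum0; rewrite (bigD1_seq x) //= -big_filter => sum0.
set s' := [seq _ <- _ | _] in sum0.
have s'B y : y \in s' -> B y.
  by rewrite mem_filter => /andP[yx ys]; apply: sB.
have cx0 : c x = 0.
  apply: contra_notP xNB => /eqP cx0; exists s', (fun y => - (c x)^-1 * c y).
  split=> //; apply: (scalerI cx0).
  move/eqP: sum0; rewrite addr_eq0 => /eqP->.
  rewrite scaler_sumr -sumrN; apply: eq_bigr => y _.
  by rewrite scalerA mulrA mulrN divff // mulN1r scaleNr.
move=> y ys; have [->//|yx] := eqVneq y x.
apply: (indB s') => //; first exact: filter_uniq.
  by rewrite cx0 scale0r add0r in sum0.
by rewrite mem_filter yx.
Qed.

(** A finite list involves finitely many members of the chain, and the largest of them contains it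
    all. The empty list is kept apart because [G] may be empty. *)
Lemma chain_bigcup_seq (G : set (set V)) s : total_on G subset ->
  (forall x, x \in s -> (\bigcup_(X in G) X) x) ->
  s = [::] \/ exists2 X, G X & forall x, x \in s -> X x.
Proof.
move=> totG; elim: s => [|x s IHs] sG; first by left.
right; have [X GX Xx] := sG x (mem_head x s).
case: IHs => [y ys|->|[Y GY sY]]; first by apply: sG; rewrite inE ys orbT.
  by exists X => // y; rewrite inE => /eqP->.
have [XY|YX] := totG X Y GX GY.
  by exists Y => // y; rewrite inE => /predU1P[->|/sY //]; apply: XY.
by exists X => // y; rewrite inE => /predU1P[->//|/sY]; apply: YX.
Qed.

(** Zorn's lemma applies to the independent subsets of [X] because a relation involves finitely many
    vectors. A maximal one spans, since an element of [X] outside its span could be adjoined. *)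
Lemma spanning_set_has_basis X : linear_span X = [set: V] ->
  exists B, B `<=` X /\ is_basis B.
Proof.
move=> spanX.
pose P := [set B | B `<=` X /\ linearly_independent B].
have [G GP totG|B [[BX indB] maxB]] := @Zorn_bigcup V P.
  split=> [x [Y /GP[YX _] /YX //]|s c s_uniq sG sum0].
  have [->//|[Y /GP[_ indY] sY]] := chain_bigcup_seq totG sG.
  exact: indY s_uniq sY sum0.
exists B; split=> //; split=> //; apply/seteqP; split=> // v _.
have : linear_span X v by rewrite spanX.
apply: linear_span_sub => x Xx; apply: contrapT => xNB.
apply: (maxB (B `|` [set x])); last first.
  by split; [move=> y [/BX //|->]|exact: linearly_independent_setU1].
split; first by move=> y By; left.
by move=> /(_ x (or_intror erefl)) /sub_linear_span.
Qed.

(** * The reflection attached to a direct sum *)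

(** Uniqueness of the components makes [e + o] to [e - o] a well-defined linear map. It yields the
    involution of an axis, with [E] the even and [O] the odd part. *)
Lemma direct_sum_reflection (E O : set V) :
  (forall k u v, E u -> E v -> E (k *: u + v)) ->
  (forall k u v, O u -> O v -> O (k *: u + v)) ->
  (forall v, E v -> O v -> v = 0) -> sum_set E O = [set: V] ->
  exists s : {linear V -> V},
    (forall u, E u -> s u = u) /\ (forall u, O u -> s u = - u).
Proof.
move=> Elin Olin EO0 EOT.
have dec v : exists p : V * V, [/\ E p.1, O p.2 & v = p.1 + p.2].
  have : sum_set E O v by rewrite EOT.
  by move=> [u Eu [w Ow <-]]; exists (u, w).
have [d dP] := choice dec.
have uniq_dec e o e' o' : E e -> O o -> E e' -> O o' ->
    e + o = e' + o' -> e = e' /\ o = o'.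
  move=> Ee Oo Ee' Oo' eqv.
  (* This vector lies in both [E] and [O], hence is zero. *)
  have eB : e - e' = o' - o.
    by apply/eqP; rewrite subr_eq addrAC eq_sym subr_eq eqv addrC.
  have B0 : e - e' = 0.
    apply: EO0; first by rewrite addrC -scaleN1r; apply: Elin.
    by rewrite eB addrC -scaleN1r; apply: Olin.
  by split; apply/eqP; rewrite ?[o == _]eq_sym -subr_eq0 -?eB B0.
have dE e o : E e -> O o -> d (e + o) = (e, o).
  move=> Ee Oo; have [E1 O2 eqv] := dP (e + o).
  have [e1 o2] := uniq_dec _ _ _ _ Ee Oo E1 O2 eqv.
  by rewrite [LHS]surjective_pairing -e1 -o2.
pose s v := (d v).1 - (d v).2.
have s_lin : linear s.
  move=> k u v; rewrite /s; have [Eu Ou equ] := dP u; have [Ev Ov eqv] := dP v.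
  have -> : k *: u + v =
      (k *: (d u).1 + (d v).1) + (k *: (d u).2 + (d v).2).
    by rewrite addrACA -scalerDr -equ -eqv.
  rewrite dE /=; [|exact: Elin|exact: Olin].
  by rewrite opprD addrACA scalerBr.
pose sL : {linear V -> V} := HB.pack s (GRing.isLinear.Build _ _ _ _ s s_lin).
(* Closure under [k *: u + v] alone would allow an empty set; the components of [0] supply an
   element to subtract from itself. *)
have E0 : E 0.
  by have [E1 _ _] := dP 0; have := Elin (-1) _ _ E1 E1; rewrite scaleN1r addNr.
have O0 : O 0.
  by have [_ O1 _] := dP 0; have := Olin (-1) _ _ O1 O1; rewrite scaleN1r addNr.
exists sL; split=> u Uu; rewrite /= /s.
  by rewrite -[u]addr0 dE //= subr0 addr0.
by rewrite -[u]add0r dE //= sub0r add0r.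
Qed.

End LinearSpan.

(** * Eigenspaces and their transport by automorphisms *)

Section AxialAlgebra.
Set Implicit Arguments.
Unset Strict Implicit.
Variables (F : fieldType) (A : lmodType F) (mul : {bilinear A -> A -> A}).
Implicit Types (a b : A) (lambda eta : F).

Lemma eigspace_linear a lambda (k : F) (u v : A) :
  eigspace mul a lambda u -> eigspace mul a lambda v ->
  eigspace mul a lambda (k *: u + v).
Proof.
rewrite /eigspace /= linearPr => -> ->.
by rewrite scalerDr !scalerA mulrC.
Qed.

Lemma eigspace0 a lambda : eigspace mul a lambda 0.
Proof. by rewrite /eigspace /= linear0r scaler0. Qed.

Section Automorphism.
Variables (phi : {linear A -> A}) (psi : A -> A).
Hypotheses (phiK : cancel phi psi) (psiK : cancel psi phi).
Hypothesis phiM : {morph phi : u v / mul u v}.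

Lemma eigspace_morph a lambda u :
  eigspace mul (phi a) lambda (phi u) = eigspace mul a lambda u.
Proof.
rewrite /eigspace /= -phiM -linearZ; apply/propext.
by split=> [/(can_inj phiK)|->].
Qed.

Lemma PC_axis_morph eta a : PC_axis mul eta a -> PC_axis mul eta (phi a).
Proof.
move=> [aa dir [f1 f2 f3 f4 f5 f6]].
(* Serves the five fusion rules whose right-hand side is a single eigenspace; the rule for two
   half-eigenvectors is transported separately at the end. *)
have lift l1 l2 l3 :
    mul_set mul (eigspace mul a l1) (eigspace mul a l2)
      `<=` eigspace mul a l3 ->
    mul_set mul (eigspace mul (phi a) l1) (eigspace mul (phi a) l2)
      `<=` eigspace mul (phi a) l3.
  move=> sub _ [u + [v + <-]]; rewrite -(psiK u) -(psiK v) !eigspace_morph.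
  by move=> uE vE; rewrite -phiM eigspace_morph; apply: sub; exists (psi u) => //;
    exists (psi v).
split; first by rewrite -phiM aa.
  move=> v; have [[[x y] z] [/= [Ex Ey Ez vE] uniq_v]] := dir (psi v).
  exists (phi x, phi y, phi z); split=> /=.
    by rewrite !eigspace_morph; split=> //; rewrite -[v]psiK vE !linearD.
  move=> [[x' y'] z'] /=.
  rewrite -(psiK x') -(psiK y') -(psiK z') !eigspace_morph => -[Ex' Ey' Ez' vE'].
  (* The competing decomposition is pulled back to [a]. As [psi] is given only as an inverse map,
     its sum formula is checked after applying the injective linear map [phi]. *)
  have vE2 : [/\ eigspace mul a 1 (psi x'),
      eigspace mul a eta (psi y'), eigspace mul a 2^-1 (psi z')
    & psi v = psi x' + psi y' + psi z'].
  by split=> //; apply: (can_inj phiK); rewrite psiK vE' !linearD.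
  by have [-> -> ->] := uniq_v (psi x', psi y', psi z') vE2.
split; try exact: lift.
move=> _ [u + [v + <-]]; rewrite -(psiK u) -(psiK v) !eigspace_morph => uE vE.
have [|x xE [y yE xy]] := f6 (mul (psi u) (psi v)).
  by exists (psi u) => //; exists (psi v).
rewrite -phiM -xy linearD; exists (phi x); first by rewrite eigspace_morph.
by exists (phi y) => //; rewrite eigspace_morph.
Qed.

Lemma primitive_PC_axis_morph eta a :
  primitive_PC_axis mul eta a -> primitive_PC_axis mul eta (phi a).
Proof.
move=> [ax a0 prim]; split; first exact: PC_axis_morph.
  by apply: contra_neq a0 => phia0; apply: (can_inj phiK); rewrite linear0.
apply/seteqP; split=> v.
  rewrite -(psiK v) eigspace_morph prim => -[k _ <-].
  by exists k => //; rewrite linearZ.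
move=> [k _ <-]; rewrite -linearZ eigspace_morph prim.
by exists k.
Qed.

End Automorphism.

(** * The involution of an axis *)

Hypothesis mulC : commutative mul.

Lemma PC_axis_involution eta a : PC_axis mul eta a ->
  exists tau : {linear A -> A},
    [/\ involutive tau, {morph tau : u v / mul u v},
        forall u, eigspace mul a 1 u -> tau u = u,
        forall u, eigspace mul a eta u -> tau u = u
      & forall u, eigspace mul a 2^-1 u -> tau u = - u].
Proof.
move=> [_ dir [f1 f2 f3 f4 f5 f6]].
set E1 := eigspace mul a 1; set Ee := eigspace mul a eta.
set Eh := eigspace mul a 2^-1.
have E10 : E1 0 := eigspace0 a 1.
have Ee0 : Ee 0 := eigspace0 a eta.
have Eh0 : Eh 0 := eigspace0 a 2^-1.
have evenlin k u v :
    sum_set E1 Ee u -> sum_set E1 Ee v -> sum_set E1 Ee (k *: u + v).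
  move=> [x Ex [y Ey <-]] [x' Ex' [y' Ey' <-]].
  exists (k *: x + x'); first exact: eigspace_linear.
  exists (k *: y + y'); first exact: eigspace_linear.
  by rewrite addrACA scalerDr.
have [|v [x Ex [y Ey vE]] Ev| |tau [tauE tauO]] :=
    direct_sum_reflection evenlin (O := Eh).
- by move=> k u v; apply: eigspace_linear.
(* A vector both even and odd has the decompositions [(0, 0, v)] and [(x, y, 0)], so it is zero. *)
- have [t [_ uniq_v]] := dir v.
  have e1 : t = (0, 0, v) by apply: uniq_v; split; rewrite //= !add0r.
  have : t = (x, y, 0) by apply: uniq_v; split; rewrite //= addr0.
  by rewrite e1 => -[_ _ ->].
- apply/seteqP; split=> // v _; have [[[x y] z] [[/= Ex Ey Ez ->] _]] := dir v.
  by exists (x + y); [exists x => //; exists y|exists z].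
(* The next three facts are the multiplication table of the grading by parity. *)
have evenM u v : sum_set E1 Ee u -> sum_set E1 Ee v -> sum_set E1 Ee (mul u v).
  move=> [x Ex [y Ey <-]] [x' Ex' [y' Ey' <-]].
  exists (mul x x' + mul y y').
    rewrite -[mul x x']scale1r; apply: eigspace_linear.
      by apply: f1; exists x => //; exists x'.
    by apply: f4; exists y => //; exists y'.
  exists (mul x y' + mul x' y).
    rewrite -[mul x y']scale1r; apply: eigspace_linear.
      by apply: f2; exists x => //; exists y'.
    by apply: f2; exists x' => //; exists y.
  rewrite linearDl !linearDr (mulC y x') addrACA; congr (_ + _).
  exact: addrC.
have oddM u v : sum_set E1 Ee u -> Eh v -> Eh (mul u v).
  move=> [x Ex [y Ey <-]] Ev; rewrite linearDl -[mul x v]scale1r.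
  apply: eigspace_linear; first by apply: f3; exists x => //; exists v.
  by apply: f5; exists y => //; exists v.
have evenh u v : Eh u -> Eh v -> sum_set E1 Ee (mul u v).
  by move=> Eu Ev; apply: f6; exists u => //; exists v.
have dec v : exists e o, [/\ sum_set E1 Ee e, Eh o & v = e + o].
  have [[[x y] z] [[/= Ex Ey Ez ->] _]] := dir v.
  by exists (x + y), z; split=> //; exists x => //; exists y.
exists tau; split.
- move=> v; have [e [o [Ee' Eo ->]]] := dec v.
  by rewrite !linearD (tauE e) // (tauO o) // linearN (tauO o) // opprK tauE.
- move=> u v; have [e [o [Eu Ou ->]]] := dec u.
  have [e' [o' [Ev Ov ->]]] := dec v.
  (* Both sides become [ee' + oo' - eo' - e'o]; commuting [o] and [e'] puts the even factor first,
     as [oddM] expects. *)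
  rewrite [in RHS](linearD tau e) [in RHS](linearD tau e').
  rewrite (tauE e) // (tauE e') // (tauO o) // (tauO o') //.
  rewrite linearBl !linearBr linearDl !linearDr !(linearD tau) (mulC o e').
  rewrite (tauE _ (evenM _ _ Eu Ev)) (tauE _ (evenh _ _ Ou Ov)).
  rewrite (tauO _ (oddM _ _ Eu Ov)) (tauO _ (oddM _ _ Ev Ou)).
  by rewrite opprB [- mul e' o + _]addrC.
- by move=> u Eu; apply: tauE; exists u => //; exists 0 => //; rewrite addr0.
- by move=> u Eu; apply: tauE; exists 0 => //; exists u => //; rewrite add0r.
- exact: tauO.
Qed.

(** * Products of primitive axes and the span as a subalgebra *)

Lemma mul_primitive_PC_axes_span eta a b : (2 : F) != 0 ->
  primitive_PC_axis mul eta a -> primitive_PC_axis mul eta b ->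
  linear_span [set c | primitive_PC_axis mul eta c] (mul a b).
Proof.
move=> two0 axa axb; set S := linear_span _.
have [[_ dir _] _ prim] := axa; have [axa' _ _] := axa.
have [tau [tauK tauM tau1 taue tauh]] := PC_axis_involution axa'.
have Sa : S a by apply: sub_linear_span.
have Sb : S b by apply: sub_linear_span.
have Stb : S (tau b).
  by apply: sub_linear_span; apply: primitive_PC_axis_morph axb.
have [[[x y] z] [[/= E1x Eey Ehz bE] _]] := dir b.
(* Primitivity of [a] enters here: [x] is a multiple of [a]. *)
have Sx : S x.
  by move: (E1x); rewrite prim => -[k _ <-]; apply: linear_spanZ.
have tbE : tau b = x + y - z.
  by rewrite bE !linearD tau1 // taue // tauh.
(* Characteristic not two allows [z] to be recovered from [b - tau b = z + z]. *)
have half (w : A) : w = (2^-1 : F) *: (w + w).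
  by rewrite -mulr2n -(scaler_nat 2 w) scalerA mulVf // scale1r.
have Sz : S z.
  rewrite [z]half; apply: linear_spanZ.
  have -> : z + z = b - tau b.
    by rewrite tbE bE opprD opprK addrACA subrr add0r.
  exact: linear_spanB.
have Sy : S y.
  have -> : y = b - z - x by rewrite bE addrK addrC addKr.
  by apply: linear_spanB Sx; apply: linear_spanB.
rewrite bE !linearDr E1x Eey Ehz.
by do !apply: linear_spanD; apply: linear_spanZ.
Qed.

(** By bilinearity, a product of two combinations is a combination of products of elements of
    [X]. *)
Lemma linear_span_subalgebra (X : set A) :
  (forall a b, X a -> X b -> linear_span X (mul a b)) ->
  subalgebra mul (linear_span X).
Proof.
move=> XM; split; first exact: linear_span0.
  exact: linear_span_linear.
move=> _ _ [s [c [sX ->]]] [t [d [tX ->]]].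
rewrite linear_sumlz; apply: linear_span_sum => x xs.
rewrite linearZl_LR; apply: linear_spanZ.
rewrite linear_sumr; apply: linear_span_sum => y yt.
by rewrite linearZr_LR; apply/linear_spanZ/XM; [apply: sX|apply: tX].
Qed.

End AxialAlgebra.

Theorem proposition3 (F : fieldType) (hchar : 2%N \notin [pchar F])
    (eta : F) (heta1 : eta != 1) (heta2 : eta != 2^-1)
    (A : lmodType F) (mul : {bilinear A -> A -> A})
    (hA : primitive_PC_axial_algebra mul eta) :
  linear_span [set a | primitive_PC_axis mul eta a] = [set: A] /\
  exists B : set A,
    B `<=` [set a | primitive_PC_axis mul eta a] /\ is_basis B.
Proof.
have two0 : (2 : F) != 0 by move: hchar; rewrite inE.
have [mulC [X [Xax Xgen]]] := hA.
suff spanT : linear_span [set a | primitive_PC_axis mul eta a] = [set: A].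
  by split=> //; apply: spanning_set_has_basis.
apply/seteqP; split=> // v _; have : smallest (subalgebra mul) X v by rewrite Xgen.
(* The subalgebra generated by [X] lies in every subalgebra containing [X], in particular in the
   span of the primitive axes. *)
apply: smallest_sub; last by move=> a /Xax; apply: sub_linear_span.
apply: linear_span_subalgebra => a b; exact: mul_primitive_PC_axes_span.
Qed.
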